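(* The set $$B=\{sd(H,G)\mid G \text{ is a finite group},\ H\in L(G)\}$$ is dense in $[0,1]$.
   Context: For a finite group $G$, $L(G)$ denotes the set (lattice) of all subgroups of $G$. For $H\in L(G)$, the relative subgroup commutativity degree of $H$ in $G$ is $$sd(H,G)=\frac{1}{|L(H)||L(G)|}\left|\{(H_1,G_1)\in L(H)\times L(G) \mid H_1G_1=G_1H_1\}\right|.$$ *)

(* Defs.v *)
From HB Require Import structures.
From mathcomp Require Import all_boot all_order all_algebra all_fingroup.
From mathcomp Require Import all_classical all_reals all_analysis.

Set Implicit Arguments.
Unset Strict Implicit.
Unset Printing Implicit Defensive.

Import GRing.Theory.
Import numFieldNormedType.Exports.

Local Open Scope classical_set_scope.
Local Open Scope ring_scope.

(* [H1 * G1] below is the product of subsets of [gT], so the pairs counted are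
   those of permuting subgroups. *)
Definition sd (R : realType) (gT : finGroupType) (H G : {group gT}) : R :=
  #|[set K in finset.setX (subgroups H) (subgroups G) |
       (K.1 * K.2 == K.2 * K.1)%g]%SET|%:R
  / (#|subgroups H| * #|subgroups G|)%N%:R.

Definition sd_values (R : realType) : set R :=
  [set x | exists (gT : finGroupType) (G H : {group gT}),
             H \in subgroups G /\ x = sd R H G].

Arguments sd_values R : clear implicits.

(* Main.v *)
(* For 1 <= j <= n and k = n - j, take a large prime p dividing a^(2^k) + 1 with
   a = N!, so that a has multiplicative order 2^(k+1) modulo p, and let a
   generator of H = C_(2^n) act on P = C_p as multiplication by a. Exactly j of
   the n+1 subgroups of H centralize P; these are central in G = P ><| H, hence
   permute with every subgroup of G. Any other subgroup of H permutes with at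
   most 2 (n+1) subgroups of G, whereas G has at least p of them (the conjugates
   of H). So sd(H, G) tends to j / (n+1) as p grows. *)
Require Import Defs.
From HB Require Import structures.
From mathcomp Require Import all_boot all_order all_algebra all_fingroup.
From mathcomp Require Import all_solvable.
From mathcomp Require Import zify.

Set Implicit Arguments.
Unset Strict Implicit.
Unset Printing Implicit Defensive.

Import GroupScope.

(** * Permutability in a semidirect product [P ><| H] with [P] of prime order *)

(** The commutator of [K] and [L] lies both in [P] and in the group [K * L] of order prime to
    [#|P|], so [L] centralizes [K]. As [K] acts nontrivially on [P], no nontrivial element of [P]
    centralizes [K], and the centralizer of [K] in [G] is just [H]. *)
Lemma sub_compl_of_permutable (gT : finGroupType) (P H G K L : {group gT}) :
    P ><| H = G -> prime #|P| -> coprime #|P| #|H| -> abelian H ->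
    K \subset H -> ~~ (K \subset 'C(P)) ->
    L \subset G -> commute (K : {set gT}) L -> P :&: L = 1 ->
  L \subset H.
Proof.
move=> defG prP coPH abH sKH ncKP sLG cKL tiPL.
have [_ defPH nPH tiPH] := sdprodP defG.
have nPG : G \subset 'N(P) by rewrite -defPH mul_subG ?normG.
have sPG : P \subset G by rewrite -defPH mulG_subl.
have dvLH : #|L| %| #|H|.
  rewrite -(dvdn_pmul2l (cardG_gt0 P)) (sdprod_card defG) -(TI_cardMg tiPL).
  by rewrite -norm_joinEr ?cardSg ?join_subG ?sPG //; exact: subset_trans nPG.
(* K L has order prime to p, so it misses P; as G / P is abelian, so is K L. *)
have defM : K <*> L = K * L by apply: comm_joingE.
have coPM : coprime #|P| #|K <*> L|.
  apply: (@coprime_dvdr _ (#|H| * #|H|)); last by rewrite coprimeMr coPH.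
  apply: dvdn_trans (dvdn_mul (cardSg sKH) dvLH).
  by rewrite mul_cardG defM dvdn_mulr.
have cLK : L \subset 'C(K).
  apply/commG1P/trivgP; rewrite -(coprime_TIg coPM) subsetI.
  have sHG : H \subset G by rewrite -defPH mulG_subr.
  apply/andP; split.
    apply: subset_trans (commgSS sLG (subset_trans sKH sHG)) _.
    by apply: der1_min => //; rewrite -defPH quotientMidl quotient_abelian.
  apply: subset_trans (commgSS (joing_subr K L) (joing_subl K L)) (der_sub 1 _).
have tiPC : P :&: 'C(K) = 1.
  by apply: prime_TIg => //; rewrite centsC.
apply/subsetP=> g Lg.
have: g \in P * H by rewrite defPH (subsetP sLG).
case/mulsgP=> u h Pu Hh def_g.
have cKh : h \in 'C(K) := subsetP (subset_trans abH (centS sKH)) h Hh.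
(* In [g = u * h] both [g] and [h] centralize [K], hence so does [u]. *)
suff /set1P u1 : u \in [1 gT] by rewrite def_g u1 mul1g.
by rewrite -[[1 gT]]tiPC inE Pu -(groupMr _ cKh) -def_g (subsetP cLK).
Qed.

(** Since [#|P|] is prime, [L] contains [P] or meets it trivially. In the first case Dedekind's law
    gives [L = P (H :&: L)]; in the second [L] lies in [H]. Each case allows at most
    [#|subgroups H|] groups. *)
Lemma card_permutable_le (gT : finGroupType) (P H G K : {group gT}) :
    P ><| H = G -> prime #|P| -> coprime #|P| #|H| -> abelian H ->
    K \subset H -> ~~ (K \subset 'C(P)) ->
  #|[set L in subgroups G | (K * L == L * K)%g]| <= 2 * #|subgroups H|.
Proof.
move=> defG prP coPH abH sKH ncKP.
have [_ defPH nPH _] := sdprodP defG.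
pose f (L : {group gT}) := (P <*> L)%G.
apply: (@leq_trans #|(f @: subgroups H) :|: subgroups H|); last first.
  rewrite (leq_trans (leq_card_setU _ _)) // mul2n -addnn.
  by rewrite leq_add2r leq_imset_card.
apply/subset_leq_card/subsetP=> L; rewrite !inE => /andP[sLG /eqP cKL].
have [sPL|tiLP] := prime_subgroupVti L prP; last first.
  by rewrite (sub_compl_of_permutable defG prP coPH abH sKH) ?orbT // setIC.
apply/orP; left; apply/imsetP.
exists (H :&: L)%G; first by rewrite inE subsetIl.
apply/val_inj => /=; rewrite norm_joinEr; last by apply: subIset; rewrite nPH.
by rewrite group_modl // defPH; apply/esym/setIidPr.
Qed.

(** The conjugates of [H] by elements of [P] are distinct: an element of [P] normalizing [H] has its
    commutators with [H] in [P :&: H = 1], so it centralizes [H] and is trivial. *)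
Lemma card_subgroups_sdprod_ge (gT : finGroupType) (P H G : {group gT}) :
    P ><| H = G -> prime #|P| -> ~~ (H \subset 'C(P)) ->
  #|P| <= #|subgroups G|.
Proof.
move=> defG prP ncHP; have [_ defPH nPH tiPH] := sdprodP defG.
have sPG : P \subset G by rewrite -defPH mulG_subl.
have sHG : H \subset G by rewrite -defPH mulG_subr.
have tiPN : P :&: 'N(H) = 1.
  apply/trivgP; rewrite -(prime_TIg prP (_ : ~~ (P \subset 'C(H)))) 1?centsC //.
  rewrite subsetI subsetIl; apply/commG1P/trivgP; rewrite -tiPH subsetI.
  apply/andP; split.
    by apply: subset_trans (commSg H (subsetIl P _)) _; rewrite commg_subl.
  by apply: subset_trans (commSg H (subsetIr P _)) _; rewrite commg_subr.
pose f u := (H :^ u)%G.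
rewrite -(@card_in_imset _ _ f P) => [|u v Pu Pv eq_f]; last first.
  apply/eqP; rewrite eq_mulgV1 -in_set1 -[[set 1]]tiPN 2!inE groupM ?groupV //=.
  by rewrite conjsgM (congr_group eq_f) /= -conjsgM mulgV conjsg1.
apply/subset_leq_card/subsetP=> _ /imsetP[u Pu ->]; rewrite inE /=.
by rewrite -(conjGid (subsetP sPG u Pu)) conjSg.
Qed.

(** * Subgroups of a cyclic 2-group, and the count of permuting pairs *)

Lemma subgroups_cycle_2group (gT : finGroupType) (x : gT) n :
    #[x] = (2 ^ n)%N ->
  subgroups <[x]> = [set <[x ^+ (2 ^ i)]>%G | i : 'I_n.+1].
Proof.
move=> ox; apply/setP=> K; rewrite inE.
apply/idP/imsetP=> [sKx | [i _ ->]]; last first.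
  by rewrite cycle_subG mem_cycle.
have := cardSg sKx; rewrite [#|<[x]>|]ox => /dvdn_pfactor[] // m le_mn cardK.
have lt : n - m < n.+1 by rewrite ltnS leq_subr.
exists (Ordinal lt) => //=; apply/set1P.
have -> : (2 ^ (n - m) = #[x] %/ #|K|)%N by rewrite ox cardK -expnB.
by rewrite -cycle_sub_group ?inE ?sKx ?eqxx // cardSg.
Qed.

(** The predicate is left general to serve twice: for all subgroups of [H], and for those
    centralizing [P]. *)
Lemma card_subgroups_cycle_2group (gT : finGroupType) (x : gT) n k
    (Q : pred {group gT}) :
    #[x] = (2 ^ n)%N -> (forall i, Q <[x ^+ (2 ^ i)]>%G = (k <= i)) ->
  #|[set K in subgroups <[x]> | Q K]| = n.+1 - k.
Proof.
move=> ox QE.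
have -> : n.+1 - k = #|[set i : 'I_n.+1 | k <= i]|.
  rewrite -[LHS]muln1 -sum_nat_const_nat big_geq_mkord -sum1_card.
  by apply: eq_bigl => i; rewrite inE.
rewrite -(@card_in_imset _ _ (fun i : 'I_n.+1 => <[x ^+ (2 ^ i)]>%G)).
  apply: eq_card => K; rewrite inE (subgroups_cycle_2group ox).
  apply/andP/imsetP => [[/imsetP[i _ ->]]|[i]].
    by rewrite QE => le_ki; exists i; rewrite ?inE.
  by rewrite inE => le_ki ->; rewrite QE; split=> //; apply/imsetP; exists i.
(* Distinct exponents give subgroups of distinct orders [2 ^ (n - i)]. *)
move=> i j _ _ /(congr1 (fun K : {group gT} => #|K|)).
have le_n (l : 'I_n.+1) : l <= n by rewrite -ltnS.
have dv (l : 'I_n.+1) : 2 ^ l %| #[x] by rewrite ox dvdn_exp2l.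
rewrite /= -!orderE !orderXdiv // ox -!expnB // => /eqP.
rewrite eqn_exp2l // => /eqP e; apply: val_inj => /=.
by rewrite -(subKn (le_n i)) e subKn.
Qed.

Lemma card_permutable_pairs (gT : finGroupType) (P H G : {group gT}) :
    P ><| H = G -> prime #|P| -> coprime #|P| #|H| -> abelian H ->
  let m := #|[set K in subgroups H | K \subset 'C(P)]| in
  let N := #|[set K in setX (subgroups H) (subgroups G) |
                (K.1 * K.2 == K.2 * K.1)%g]| in
  m * #|subgroups G| <= N /\ N <= m * #|subgroups G| + 2 * #|subgroups H| ^ 2.
Proof.
move=> defG prP coPH abH m N.
have [_ defPH _ _] := sdprodP defG.
pose c (K : {group gT}) := #|[set L in subgroups G | (K * L == L * K)%g]|.
have -> : N = \sum_(K in subgroups H) c K.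
  rewrite /N -sum1_card; under [RHS]eq_bigr do rewrite /c -sum1_card.
  by rewrite pair_big_dep /=; apply: eq_bigl => -[K L]; rewrite !inE /= andbA.
(* [K] centralizes [P] by assumption and [H] because [H] is abelian, so it is central in [G]. *)
have c_cent K : K \in subgroups H -> K \subset 'C(P) -> c K = #|subgroups G|.
  rewrite inE => sKH cKP; apply: eq_card => L; rewrite !inE.
  case sLG: (L \subset G) => //=; apply/eqP/centC.
  apply: subset_trans (centS sLG); rewrite -defPH centM subsetI cKP.
  exact: subset_trans sKH abH.
rewrite (bigID (fun K : {group gT} => K \subset 'C(P))) /=.
rewrite (eq_bigr (fun=> #|subgroups G|)); last first.
  by move=> K /andP[]; exact: c_cent.
have -> : \sum_(K in subgroups H | K \subset 'C(P)) #|subgroups G| =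
          (m * #|subgroups G|)%N.
  by rewrite -sum_nat_const; apply: eq_bigl => K; rewrite !inE.
rewrite leq_addr; split=> //; rewrite leq_add2l.
apply: (@leq_trans (\sum_(K in subgroups H) 2 * #|subgroups H|)); last first.
  by rewrite sum_nat_const mulnCA expnS expn1.
rewrite big_mkcondr /=; apply: leq_sum => K; rewrite inE => sKH.
by case: ifP => // ncKP; apply: (card_permutable_le defG).
Qed.

(** * Affine maps of ['F_p] with a cyclic 2-group of dilations *)

Section AffineGroup.
Variables (p k n : nat) (a : 'F_p).
Hypotheses (pr_p : prime p) (p_gt2 : 2 < p) (n_gt0 : 0 < n) (le_kn : k < n).
Hypothesis aN1 : (a ^+ (2 ^ k) = -1)%R.
Import GRing.Theory.

Let a_neq0 : (a != 0)%R.
Proof.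
apply/eqP=> a0; have := aN1; rewrite a0 expr0n expn_eq0 /= => /esym/eqP.
by rewrite oppr_eq0 oner_eq0.
Qed.

(** Squaring [-1] gives 1, while [-1] itself differs from 1 because [p] is odd; thus [a] has order
    [2 ^ k.+1]. *)
Lemma expr_pow2_eq1 i : (a ^+ (2 ^ i) == 1)%R = (k < i).
Proof.
have m1 : (-1 != 1 :> 'F_p)%R.
  rewrite eq_sym -subr_eq0 opprK -mulr2n -(dvdn_pcharf (pchar_Fp pr_p)).
  by apply/negP=> /dvdn_leq -/(_ isT); lia.
case: ltnP => [lt_ki | le_ik].
  rewrite -(subnKC lt_ki) expnD exprM expnS mulnC exprM aN1.
  by rewrite sqrrN expr1n expr1n.
apply/negP=> /eqP ai; move: m1; rewrite -aN1 -(subnKC le_ik) expnD exprM ai.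
by rewrite expr1n eqxx.
Qed.

Definition transl (c : 'F_p) : {perm 'F_p} := perm (addIr c).
Definition dilate : {perm 'F_p} := perm (mulIf a_neq0).

Lemma transl_exp c m : transl c ^+ m = transl (c *+ m)%R.
Proof.
apply/permP=> v; elim: m => [|m IHm].
  by rewrite expg0 perm1 permE mulr0n addr0.
by rewrite expgSr permM IHm !permE mulrSr addrA.
Qed.

Lemma dilate_exp m v : (dilate ^+ m) v = (v * a ^+ m)%R.
Proof.
elim: m => [|m IHm]; first by rewrite expg0 perm1 mulr1.
by rewrite expgSr permM IHm permE exprSr mulrA.
Qed.

(* In the group 'Z_m, 1 is the residue 0 and Zp1 is the generator. *)
Definition aff_transl : 'Z_(2 ^ n) * {perm 'F_p} := (1, transl 1%R).
Definition aff_cycle : 'Z_(2 ^ n) * {perm 'F_p} := (Zp1, dilate).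

Lemma expg_pair (aT bT : finGroupType) (u : aT) (v : bT) m :
  (u, v) ^+ m = (u ^+ m, v ^+ m).
Proof. by elim: m => // m IHm; rewrite !expgS IHm. Qed.

Lemma order_aff_transl : #[aff_transl] = p.
Proof.
apply: nt_prime_order => //.
  have p0 : (1 *+ p = 0 :> 'F_p)%R by exact: pcharf0 (pchar_Fp pr_p).
  rewrite expg_pair expg1n transl_exp p0.
  by congr pair; apply/permP=> v; rewrite permE perm1 addr0.
apply/eqP=> -[/permP/(_ 0%R)]; rewrite permE perm1 add0r => /eqP.
by rewrite oner_eq0.
Qed.

(** The dilation alone has order [2 ^ k.+1], which may be smaller than [2 ^ n]; the coordinate [Zp1]
    forces the full order. *)
Lemma order_aff_cycle : #[aff_cycle] = (2 ^ n)%N.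
Proof.
have m_gt1 : 1 < 2 ^ n by rewrite -(expn0 2) ltn_exp2l.
apply/eqP; rewrite eqn_dvd; apply/andP; split.
  rewrite order_dvdn expg_pair; apply/eqP; congr pair.
    by apply/eqP; rewrite -order_dvdn order_Zp1 Zp_cast.
  apply/permP=> v; rewrite dilate_exp perm1.
  by rewrite (eqP (_ : a ^+ (2 ^ n) == 1)%R) ?mulr1 // expr_pow2_eq1.
have := expg_order aff_cycle; rewrite expg_pair => -[/eqP + _].
by rewrite -order_dvdn order_Zp1 Zp_cast.
Qed.

Lemma aff_cycle_norm : <[aff_cycle]> \subset 'N(<[aff_transl]>).
Proof.
rewrite cycle_subG inE -cycleJ cycle_subG.
(* Conjugating the translation by 1 with the dilation yields the translation by [a], a power whose
   exponent is [a] read as a natural number. *)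
apply/cycleP; exists a; rewrite expg_pair expg1n transl_exp.
have -> : aff_transl ^ aff_cycle = (1 ^ Zp1, transl 1%R ^ dilate) by [].
rewrite conj1g; congr pair; apply: (@mulgI _ dilate); rewrite -conjgC.
by apply/permP=> v; rewrite !permE /= !permE mulrDl mul1r natr_Zp.
Qed.

Lemma aff_cycle_cent i :
  (<[aff_cycle ^+ (2 ^ i)]> \subset 'C(<[aff_transl]>)) = (k < i).
Proof.
rewrite cent_cycle cycle_subG -expr_pow2_eq1 cent1E /aff_cycle expg_pair.
(* Evaluated at 0, commutation with the translation by 1 says that [a ^+ (2 ^ i)] is 1. *)
apply/eqP/eqP => [[_ /permP/(_ 0%R)] | ai].
  by rewrite !permE /= !dilate_exp !permE mul0r !add0r mul1r => ->.
congr pair; first by rewrite /= mulg1 mul1g.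
by apply/permP=> v; rewrite !permM /= !permE !dilate_exp ai !mulr1.
Qed.

End AffineGroup.

Lemma pow2_root_opp1 k N :
  exists2 p, prime p & N < p /\ exists a : 'F_p, (a ^+ (2 ^ k) = -1)%R.
Proof.
have M_gt1 : 1 < (N`! ^ (2 ^ k)).+1 by rewrite ltnS expn_gt0 fact_gt0.
exists (pdiv (N`! ^ (2 ^ k)).+1); set p := pdiv _; first exact: pdiv_prime.
have pr_p : prime p by apply: pdiv_prime.
have p_dv : p %| (N`! ^ (2 ^ k)).+1 by apply: pdiv_dvd.
split.
  (* A prime [p <= N] would divide [N!], hence also 1. *)
  rewrite ltnNge; apply/negP=> le_pN; move: p_dv; rewrite -addn1 dvdn_addr.
    by rewrite dvdn1 => /eqP p1; rewrite p1 in pr_p.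
  by apply: dvdn_exp; rewrite ?expn_gt0 // dvdn_fact // prime_gt0.
exists (N`!%:R)%R; rewrite -GRing.natrX; apply/eqP.
by rewrite -GRing.addr_eq0 GRing.natr1 -(GRing.dvdn_pcharf (pchar_Fp pr_p)).
Qed.

Lemma affine_group_family n j N : 0 < j <= n ->
  exists (gT : finGroupType) (G H : {group gT}) (M : nat),
    [/\ H \in subgroups G, #|subgroups H| = n.+1, N < #|subgroups G|,
        #|[set K in setX (subgroups H) (subgroups G) |
             (K.1 * K.2 == K.2 * K.1)%g]| = j * #|subgroups G| + M &
        M <= 2 * n.+1 ^ 2].
Proof.
case/andP=> j_gt0 le_jn; pose k := n - j.
have lt_kn : k < n by rewrite /k; lia.
have n_gt0 : 0 < n by lia.
(* The maximum with 2 makes [p] odd as well as large. *)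
have [p pr_p [lt_Np [a aN1]]] := pow2_root_opp1 k (maxn N 2).
have p_gt2 : 2 < p by lia.
pose P := <[aff_transl p n]>%G; pose H := <[aff_cycle n aN1]>%G.
have oP : #|P| = p by exact: order_aff_transl.
have oH : #|H| = (2 ^ n)%N by exact: order_aff_cycle.
have coPH : coprime #|P| #|H|.
  rewrite oP oH coprimeXr // prime_coprime // dvdn_prime2 //.
  by rewrite gtn_eqF.
have prP : prime #|P| by rewrite oP.
have defG : P ><| H = P <*> H.
  by apply: sdprodEY; [exact: aff_cycle_norm | exact: coprime_TIg].
have cP i : (<[aff_cycle n aN1 ^+ (2 ^ i)]> \subset 'C(P)) = (k < i).
  exact: aff_cycle_cent.
have ox : #[aff_cycle n aN1] = (2 ^ n)%N by exact: order_aff_cycle.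
have ch : #|subgroups H| = n.+1.
  rewrite -[RHS]subn0 -(card_subgroups_cycle_2group (Q := predT) ox) //.
  by apply: eq_card => K; rewrite !inE andbT.
have cm : #|[set K in subgroups H | K \subset 'C(P)]| = j.
  pose Q (K : {group _}) := K \subset 'C(P).
  (* The threshold is [k.+1], so the count is [n.+1 - k.+1 = n - k = j]. *)
  rewrite (card_subgroups_cycle_2group (Q := Q) ox cP).
  by rewrite subSS subKn.
have ncHP : ~~ (H \subset 'C(P)).
  by have := cP 0; rewrite expn0 expg1 ltn0 => ->.
have [lo up] := card_permutable_pairs defG prP coPH (cycle_abelian _).
rewrite cm ch in lo up.
exists _, (P <*> H)%G, H, (#|[set K in setX (subgroups H) (subgroups (P <*> H))
  | (K.1 * K.2 == K.2 * K.1)%g]| - j * #|subgroups (P <*> H)|)%N.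
split=> //.
- by rewrite inE joing_subr.
- apply: leq_trans (card_subgroups_sdprod_ge defG prP ncHP).
  by rewrite oP; lia.
- by rewrite subnKC.
- by rewrite leq_subLR.
Qed.

(* Real estimates and density *)
From mathcomp Require Import ring lra.
From mathcomp Require Import all_classical all_reals all_analysis.

Import GRing.Theory Num.Theory Order.TTheory.
Import numFieldNormedType.Exports.

Local Open Scope classical_set_scope.
Local Open Scope ring_scope.

Lemma sd_itv (R : realType) (gT : finGroupType) (H G : {group gT}) :
  0 <= sd R H G <= 1.
Proof.
rewrite /sd divr_ge0 ?ler0n //=.
have gt0 (K : {group gT}) : (0 < #|subgroups K|)%N.
  by apply/card_gt0P; exists K; rewrite inE.
rewrite ler_pdivrMr ?ltr0n ?muln_gt0 ?gt0 // mul1r ler_nat -cardsX.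
by apply/subset_leq_card/fintype.subsetP => K; rewrite inE => /andP[].
Qed.

(** The excess over [j / n.+1] is [M / (n.+1 * g)] with [g = #|subgroups G|]; the bound on [M] does
    not involve [g], and [g] exceeds [N.+1]. *)
Lemma sd_near_ratio (R : realType) n j N : (0 < j <= n)%N ->
  exists2 z, sd_values R z &
    j%:R / n.+1%:R <= z <= j%:R / n.+1%:R + 2 * n.+1%:R / N.+1%:R.
Proof.
move=> /(affine_group_family N.+1)[gT [G [H [M [HG ch lt_N cN le_M]]]]].
exists (sd R H G); first by exists gT, G, H.
rewrite /sd cN ch; set g := #|subgroups G| in lt_N *.
have g_gt0 : 0 < g%:R :> R by rewrite ltr0n; lia.
have n_gt0 : 0 < n.+1%:R :> R by rewrite ltr0n.
rewrite natrD !natrM invfM mulrDl.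
have -> : j%:R * g%:R * (n.+1%:R^-1 * g%:R^-1) = j%:R / n.+1%:R :> R.
  by field; rewrite !gt_eqF.
rewrite lerDl lerD2l -invfM -!natrM divr_ge0 ?ler0n //=.
rewrite ler_pdivrMr ?natrM ?mulr_gt0 // mulrAC ler_pdivlMr ?ltr0n //.
rewrite -!natrM ler_nat; nia.
Qed.

Theorem proposition4p1 (R : realType) :
  closure (sd_values R) = `[0, 1]%classic.
Proof.
apply/seteqP; split.
  have /closure_id -> : closed (`[0, 1]%classic : set R) by exact: itv_closed.
  apply: closure_subset => _ [gT [G [H [_ ->]]]].
  by rewrite /= in_itv /= sd_itv.
move=> y /=; rewrite in_itv /= => /andP[y_ge0 y_le1].
move=> B /nbhs_ballP[e /= e_gt0 sB].
(* The radius [e] is split in two: [n] brings [j / n.+1] within [e / 2] of [y], and [N] keeps the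
   excess of [sd] over that ratio below [e / 2]. *)
pose n := (Num.truncn (4 / e)).+1.
pose i := Num.truncn (y * n%:R).
(* The family needs [j > 0]; raising 0 to 1 keeps [j] within 1 of [y * n]. *)
pose j := maxn i 1.
pose N := Num.truncn (4 * n.+1%:R / e).
have n_gt0 : 0 < n%:R :> R by rewrite ltr0n.
have n1_gt0 : 0 < n.+1%:R :> R by rewrite ltr0n.
have yn_ge0 : 0 <= y * n%:R by rewrite mulr_ge0 // ltW.
have /andP[le_i lt_i] := truncn_itv yn_ge0; rewrite -/i in le_i lt_i.
have jn : (0 < j <= n)%N.
  rewrite leq_max orbT geq_max /= andbT -(ler_nat R).
  by apply: le_trans le_i _; rewrite ler_piMl // ltW.
have [jy_ge jy_le] : y * n%:R - 1 <= j%:R /\ j%:R <= y * n%:R + 1.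
  rewrite /j; case: (posnP i) => [i0|i_gt0]; last first.
    by rewrite (maxn_idPl i_gt0); rewrite -natr1 in lt_i; split; lra.
  by rewrite i0 max0n; rewrite i0 in lt_i; split; lra.
have [z Sz /andP[le_z z_le]] := sd_near_ratio R N jn.
exists z; split=> //; apply: sB; rewrite /ball /=.
have error_lt : 2 * n.+1%:R / N.+1%:R < e / 2.
  have := truncnS_gt (4 * n.+1%:R / e); rewrite -/N ltr_pdivrMr // => lt_N.
  by rewrite ltr_pdivrMr ?ltr0n //; lra.
have lt_n : 2 < n%:R * (e / 2).
  by have := truncnS_gt (4 / e); rewrite -/n ltr_pdivrMr // => lt_n; lra.
set r := j%:R / n.+1%:R in le_z z_le.
have def_r : r * (n%:R + 1) = j%:R by rewrite natr1 mulfVK // gt_eqF.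
(* After multiplication by [n + 1], rounding costs at most 1 and replacing [n] by [n + 1] costs
   [y <= 1]; the total of 2 is below [n * (e / 2)]. *)
have [r_gt r_lt] : y - e / 2 < r /\ r < y + e / 2.
  by split; rewrite -(ltr_pM2r n1_gt0) -[n.+1%:R]natr1 def_r; lra.
set d := 2 * n.+1%:R / N.+1%:R in z_le error_lt.
by rewrite ltr_distl; apply/andP; split; lra.
Qed.
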